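(* Let $L=\mathbb{Q}^{\mathrm{tr}}(i)$ and let $x\in\mathcal{O}_L$ be a non-zero element. If $n(x)<\frac12\log\frac{1+\sqrt5}{2}$, then the ideal $x\mathcal{O}_{\mathbb{Q}(x)}$ is not large in $L$, except if $x$ is a unit.
   Context: $\mathbb{Q}^{\mathrm{tr}}\subseteq\overline{\mathbb{Q}}$ is the compositum of all totally real number fields, and $\mathcal{O}_L$ denotes the ring of algebraic integers in $L$. For $x\in\overline{\mathbb{Q}}^\times$, the logarithmic norm is $n(x)=\frac{\log|N_{\mathbb{Q}(x)/\mathbb{Q}}(x)|}{[\mathbb{Q}(x):\mathbb{Q}]}$. For a number field $K'$, an element $y\in\mathcal{O}_{K'}$ is large if $|\sigma(y)|\ge1$ for every embedding $\sigma:K'\to\mathbb{C}$; an ideal of $\mathcal{O}_{K'}$ is large if it is principal and has a large generator. If $L$ is an infinite algebraic extension of a number field $K$, an ideal $\mathfrak{A}\subseteq\mathcal{O}_K$ is large in $L$ if there is a number field $K'$ with $K\subseteq K'\subseteq L$ such that $\mathfrak{A}\mathcal{O}_{K'}$ is large in $\mathcal{O}_{K'}$. *)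

(* Defs.v *)
From HB Require Import structures.
From mathcomp Require Import all_boot all_order all_algebra all_field.
From mathcomp Require Import boolp classical_sets reals exp.
From mathcomp Require Import complex.
Set Implicit Arguments.
Unset Strict Implicit.
Unset Printing Implicit Defensive.
Import Order.TTheory GRing.Theory Num.Theory.
Local Open Scope classical_set_scope.
Local Open Scope ring_scope.

(* The algebraic closure of Q is algC; R is the field of real numbers and R[i]
   the field of complex numbers.  A number field is a K : fieldExtType rat; it
   is viewed as a subfield of algC through a morphism iota : K -> algC, the
   subfield being range iota. *)

Definition subfield_of_algC (F : set algC) : Prop :=
  GRing.divring_closed (mem F).

(* A number field is totally real if all its complex embeddings are real. *)
Definition totally_real (R : realType) (K : fieldExtType rat) : Prop :=
  forall (sigma : {rmorphism K -> R[i]}) (z : K), sigma z \is Num.real.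

Definition compositum (S : set (set algC)) : set algC :=
  smallest subfield_of_algC (\bigcup_(F in S) F).

Definition Qtr (R : realType) : set algC :=
  compositum [set F | exists (K : fieldExtType rat)
                             (iota : {rmorphism K -> algC}),
                        totally_real R K /\ F = range iota].

Definition Qtr_i (R : realType) : set algC :=
  smallest subfield_of_algC (Qtr R `|` [set 'i]).

Definition integers_in (L : set algC) : set algC :=
  [set z | L z /\ z \in Aint].

Definition unit_of (A : set algC) (x : algC) : Prop :=
  A x /\ exists2 y, A y & x * y = 1.

(* The number field Q(x), with its inclusion into algC and the element x. *)
Definition Qadj (x : algC) : fieldExtType rat :=
  tag (num_field_exists [:: x]).

Definition Qadj_incl (x : algC) : {rmorphism Qadj x -> algC} :=
  tag (tagged (num_field_exists [:: x])).

Definition Qadj_gen (x : algC) : Qadj x :=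
  head 0 (s2val (tagged (tagged (num_field_exists [:: x])))).

Lemma Qadj_inclK (x : algC) : Qadj_incl x (Qadj_gen x) = x.
Proof.
rewrite /Qadj_incl /Qadj_gen /Qadj.
by case: num_field_exists => Q [f [[|a []] //= [fa] _]].
Qed.

Lemma Qadj_genP (x : algC) : <<1; Qadj_gen x>>%VS = {:Qadj x}%VS.
Proof.
rewrite /Qadj_gen /Qadj.
case: num_field_exists => Q [f [[|a []] //= _ genQ]].
by rewrite -genQ adjoin_seq1.
Qed.

(* N_{K/Q}(a) is the determinant of multiplication by a on K over Q. *)
Definition field_norm (K : fieldExtType rat) (a : K) : rat :=
  \det (passmx.mxof (vbasis {:K}) (vbasis {:K}) (amull a)).

Definition log_norm (R : realType) (x : algC) : R :=
  ln `|ratr (field_norm (Qadj_gen x))| / (\dim {:Qadj x})%:R.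

Definition ring_of_integers (K : fieldExtType rat) : set K :=
  [set z | integralOver (intr : int -> K) z].

Definition is_ideal (K : fieldExtType rat) (I : set K) : Prop :=
  [/\ I `<=` @ring_of_integers K, I 0,
      forall a b, I a -> I b -> I (a + b)
    & forall c a, ring_of_integers c -> I a -> I (c * a)].

Definition principal_ideal (K : fieldExtType rat) (y : K) : set K :=
  [set y * c | c in @ring_of_integers K].

(* I O_K', where K -> K' is the inclusion phi. *)
Definition extend_ideal (K K' : fieldExtType rat) (phi : {rmorphism K -> K'})
    (I : set K) : set K' :=
  smallest (@is_ideal K') (phi @` I).

Definition large_element (R : realType) (K : fieldExtType rat) (y : K) : Prop :=
  ring_of_integers y /\
  forall sigma : {rmorphism K -> R[i]}, 1 <= `|sigma y|.

Definition large_ideal (R : realType) (K : fieldExtType rat) (I : set K) :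
    Prop :=
  exists2 y : K, large_element R y & I = principal_ideal y.

(* K is a subfield of algC through iota; the ideal I of O_K is large in L. *)
Definition large_in (R : realType) (L : set algC) (K : fieldExtType rat)
    (iota : {rmorphism K -> algC}) (I : set K) : Prop :=
  exists (K' : fieldExtType rat) (iota' : {rmorphism K' -> algC})
         (phi : {rmorphism K -> K'}),
    [/\ iota' \o phi =1 iota, range iota' `<=` L
      & large_ideal R (extend_ideal phi I)].

(* Main.v *)
(* Suppose that y is a large generator of x O_K', and let w be its complex
   conjugate.  As y lies in Q^tr(i), every embedding tau sends z = y w to
   |tau y|^2 >= 1.  If z = 1 then y, hence x, is a unit.  Otherwise z - 1 is a
   nonzero integer, so |N(z - 1)| >= 1, and t^2 >= 4 (t - 1) at each conjugate t
   of z gives |N(z)| >= 2^n, that is, n(x) = n(y) >= (log 2) / 2, while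
   (1 + sqrt 5) / 2 < 2.  Norms from different fields are compared through the
   fact that the characteristic polynomial of multiplication by an element is
   a power of its minimal polynomial over Q. *)

From HB Require Import structures.
Require Import Defs.
From mathcomp Require Import all_boot all_order all_algebra all_field.
From mathcomp Require Import boolp classical_sets reals exp.
From mathcomp Require Import complex ring lra.
Import Order.TTheory GRing.Theory Num.Theory.
Local Open Scope ring_scope.

(** * Multiplication matrices and embeddings of a number field *)

Lemma horner_char_poly (F : comNzRingType) (n : nat) (A : 'M[F]_n) (t : F) :
  (char_poly A).[t] = \det (t%:M - A).
Proof.
rewrite -horner_evalE /char_poly -det_map_mx; congr (\det _).
by apply/matrixP=> i j; rewrite !mxE /= /horner_eval !hornerE hornerMn hornerX.
Qed.

Definition mulmat {K : fieldExtType rat} (a : K) : 'M[rat]_(\dim {:K}) :=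
  passmx.mxof (vbasis {:K}) (vbasis {:K}) (amull a).

Section NumberField.

Variable K : fieldExtType rat.
Implicit Types a b c : K.

Lemma mulmat_linear : linear (@mulmat K).
Proof. by move=> r a b; rewrite /mulmat linearP passmx.mxof_linear. Qed.

HB.instance Definition _ :=
  GRing.isLinear.Build _ _ _ _ _ mulmat_linear.

Lemma mulmat1 : mulmat (1 : K) = 1%:M.
Proof.
by rewrite /mulmat amull1 passmx.mxof1 // (basis_free (vbasisP _)).
Qed.

Lemma mulmatM a b : mulmat (a * b) = mulmat a *m mulmat b.
Proof.
rewrite /mulmat -(passmx.mxof_comp _ _ (vbasisP _)); congr passmx.mxof.
by apply/lfunP=> c; rewrite comp_lfunE !lfunE /= mulrCA mulrA.
Qed.

Lemma dim_gt0 : (0 < \dim {:K})%N.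
Proof. by apply: leq_trans (dimvS (sub1v {:K}%AS)); rewrite dimv1. Qed.

Lemma ratr_horner (F : numFieldType) (sigma : {rmorphism K -> F}) a q :
  sigma (horner_alg a q) = (map_poly ratr q).[sigma a].
Proof.
rewrite -horner_map -map_poly_comp; congr _.[_].
by apply: eq_map_poly => r /=; rewrite alg_num_field fmorph_rat.
Qed.

Lemma root_ratr (F : numFieldType) (sigma : {rmorphism K -> F}) a q :
  root (map_poly ratr q) (sigma a) = (horner_alg a q == 0).
Proof. by rewrite /root -ratr_horner fmorph_eq0. Qed.

(* The vector of basis elements is an eigenvector, over K itself, of mulmat a. *)
Lemma horner_char_poly_mulmat a : horner_alg a (char_poly (mulmat a)) = 0.
Proof.
have -> : horner_alg a (char_poly (mulmat a))
    = \det (a%:M - map_mx (in_alg K) (mulmat a)).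
  by rewrite -horner_char_poly -map_char_poly.
set B := a%:M - _.
pose e : 'cV[K]_(\dim {:K}) := \col_i (vbasis {:K})`_i.
have Be0 : B *m e = 0.
  rewrite mulmxBl mul_scalar_mx; apply/eqP; rewrite subr_eq0; apply/eqP.
  apply/colP=> i; rewrite !mxE.
  rewrite -{1}(passmx.vecof_delta (vbasis {:K})).
  have := passmx.hom_vecof (vbasis {:K}) (vbasisP _) (amull a) (delta_mx 0 i).
  rewrite lfunE /= => ->; rewrite /passmx.vecof.
  by apply: eq_bigr => j _; rewrite -rowE !mxE mulr_algl.
have : \adj B *m B *m e = 0 by rewrite -mulmxA Be0 mulmx0.
rewrite mul_adj_mx mul_scalar_mx => /matrixP dBe.
have [i ei] : exists i : 'I_(\dim {:K}), (vbasis {:K})`_i != 0.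
  exists (Ordinal dim_gt0).
  apply: (free_not0 (basis_free (vbasisP {:K}))).
  by rewrite mem_nth // size_tuple dim_gt0.
by move: (dBe i 0); rewrite !mxE => /eqP; rewrite mulf_eq0 (negPf ei) orbF => /eqP.
Qed.

(** A common eigenvector of all multiplication matrices defines a character: its eigenvalue, as a
    function of [b], inherits additivity and multiplicativity from [mulmat]. By linearity, stability
    need only be tested on a basis. *)
Lemma embedding_of_eigenvector (C : fieldType) (f : {rmorphism rat -> C})
    (u : 'rV[C]_(\dim {:K})) :
  u != 0 -> all (fun b => stablemx u (map_mx f (mulmat b))) (vbasis {:K}) ->
  exists sigma : {rmorphism K -> C},
    forall b, u *m map_mx f (mulmat b) = sigma b *: u.
Proof.
move=> u0 /allP u_st.
have st b : {l | u *m map_mx f (mulmat b) = l *: u}.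
  apply: cid.
  have : (u *m map_mx f (mulmat b) <= u)%MS.
    rewrite (coord_vbasis (memvf b)).
    rewrite linear_sum.
    rewrite map_mx_sum mulmx_sumr summx_sub // => i _.
    rewrite linearZ /= map_mxZ -scalemxAr scalemx_sub //; apply: u_st.
    by rewrite mem_nth // size_tuple.
  by case/sub_rVP=> l ->; exists l.
pose s b := sval (st b).
have sE b : u *m map_mx f (mulmat b) = s b *: u := svalP (st b).
have uI l m : l *: u = m *: u -> l = m.
  move/eqP; rewrite -subr_eq0 -scalerBl scaler_eq0 (negPf u0) orbF subr_eq0.
  by move/eqP.
have sB : zmod_morphism s.
  move=> a b; apply: uI; by rewrite -sE scalerBl -!sE linearB /= map_mxB mulmxBr.
have sM : monoid_morphism s.
  split=> [|a b]; apply: uI; first by rewrite -sE mulmat1 map_mx1 mulmx1 scale1r.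
  by rewrite -sE mulmatM map_mxM mulmxA sE -scalemxAl sE scalerA mulrC.
pose hA := GRing.isZmodMorphism.Build K C s sB.
pose hM := GRing.isMonoidMorphism.Build K C s sM.
pose sigma : {rmorphism K -> C} := HB.pack s hA hM.
by exists sigma.
Qed.

(** Multiplication matrices commute, so all of them preserve the eigenspace of [mulmat a] for [l].
    Over an algebraically closed field they have a common eigenvector inside it, whose character
    sends [a] to [l]. *)
Lemma embedding_of_eigenvalue (C : numClosedFieldType) a l :
  eigenvalue (map_mx ratr (mulmat a)) l ->
  exists sigma : {rmorphism K -> C}, sigma a = l.
Proof.
set f : {rmorphism rat -> C} := ratr; set A := map_mx f (mulmat a) => a_eigen.
set V := eigenspace A l.
have comm b c : comm_mx (map_mx f (mulmat b)) (map_mx f (mulmat c)).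
  by rewrite /comm_mx -!map_mxM -!mulmatM mulrC.
have Vst b : stablemx V (map_mx f (mulmat b)).
  by apply: comm_mx_stable_eigenspace; apply: comm.
have [] := @common_eigenvector _ _
  [seq restrictmx V (map_mx f (mulmat b)) | b <- vbasis {:K}].
- by rewrite lt0n mxrank_eq0.
- move=> _ _ /mapP[b _ ->] /mapP[c _ ->].
  rewrite /comm_mx -!conjmxM ?inE ?stablemx_row_base //.
  by rewrite (comm b c).
move=> v v0 /allP vP.
have u0 : v *m row_base V != 0 by rewrite mulmx_free_eq0 ?row_base_free.
case: (embedding_of_eigenvector _ f _ u0) => [|sigma sigmaE].
  apply/allP=> b bK; rewrite -stablemx_restrict // vP //; exact: map_f.
exists sigma.
have /eigenspaceP : (v *m row_base V <= V)%MS.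
  by rewrite mulmx_sub // eq_row_base.
rewrite sigmaE => /eqP; rewrite -subr_eq0 -scalerBl scaler_eq0 (negPf u0) orbF.
by rewrite subr_eq0 => /eqP.
Qed.

Lemma embedding_exists (C : numClosedFieldType) :
  inhabited {rmorphism K -> C}.
Proof.
have [l] := eigenvalue_closed (map_mx (ratr : rat -> C) (mulmat (1 : K))) dim_gt0.
by case/embedding_of_eigenvalue=> sigma _; split.
Qed.

(** The list [s] holds the eigenvalues of [mulmat a] with multiplicity. The shift by [r] lets one
    list serve for the norms of both [a] and [a - 1]. *)
Lemma field_norm_conjugates (C : numClosedFieldType) a :
  exists s : seq C,
  [/\ size s = \dim {:K},
      forall l, l \in s -> exists sigma : {rmorphism K -> C}, sigma a = l
    & forall r : rat,
       ratr (field_norm (a - r%:A)) = \prod_(l <- s) (l - ratr r) :> C].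
Proof.
set A := map_mx (ratr : rat -> C) (mulmat a).
have [s] := closed_field_poly_normal (char_poly A).
rewrite (monicP (char_poly_monic _)) scale1r => sE.
have size_s : size s = \dim {:K}.
  by apply: succn_inj; rewrite -(size_prod_XsubC s id) -sE size_char_poly.
exists s; split=> // [l ls|r].
  apply: embedding_of_eigenvalue.
  by rewrite eigenvalue_root_char sE root_prod_XsubC.
rewrite /field_norm -/(mulmat _) linearB linearZ /= mulmat1 scalemx1.
(* As [A - r] is [-(r - A)], the norm is [(-1) ^+ n] times the characteristic polynomial at [r]; the
   sign is then spread over the [n] factors [r - l]. *)
rewrite -opprB -scaleN1r detZ rmorphM rmorphXn rmorphN1.
rewrite -det_map_mx map_mxB map_scalar_mx -horner_char_poly sE horner_prod.
have -> : (-1) ^+ \dim {:K} = \prod_(l <- s) (-1) :> C.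
  by rewrite big_const_seq count_predT iter_mulr_1 size_s.
rewrite -big_split; apply: eq_bigr => l _.
by rewrite !hornerE /= mulN1r opprB.
Qed.

End NumberField.

(** Having the same image in [F], [a] and [b] satisfy the same rational polynomials. So [tau b] is a
    root of the characteristic polynomial of [mulmat a], hence an eigenvalue. *)
Lemma conjugate_embedding (K K' : fieldExtType rat) (F : numFieldType)
    (C : numClosedFieldType) (iota : {rmorphism K -> F})
    (iota' : {rmorphism K' -> F}) (tau : {rmorphism K' -> C}) (a : K) (b : K') :
  iota a = iota' b -> exists sigma : {rmorphism K -> C}, sigma a = tau b.
Proof.
move=> ab; apply: embedding_of_eigenvalue.
rewrite eigenvalue_root_char -map_char_poly root_ratr.
by rewrite -(root_ratr _ _ iota') -ab root_ratr horner_char_poly_mulmat.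
Qed.

(** * Algebraic integers and integrality of norms *)

Lemma integralOver_fmorph (F F' : fieldType) (f : {rmorphism F -> F'}) (z : F) :
  integralOver (intr : int -> F') (f z) <-> integralOver (intr : int -> F) z.
Proof.
suff E (p : {poly int}) : root (map_poly intr p) (f z) = root (map_poly intr p) z.
  by split=> -[p p_monic]; rewrite ?E => pz; exists p; rewrite ?E.
rewrite -(fmorph_root f) -map_poly_comp; congr (root _ _).
by apply: eq_map_poly => m /=; rewrite rmorph_int.
Qed.

Lemma Aint_integralOver (z : algC) :
  z \in Aint <-> integralOver (intr : int -> algC) z.
Proof.
split=> [z_int|[p p_monic pz]].
  have [p pE] := floorpP z_int.
  exists p; last by rewrite -pE root_minCpoly.
  have := minCpoly_monic z; rewrite pE !monicE lead_coef_map_inj ?rmorph0 //.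
    by rewrite (eqr_int _ _ 1).
  exact: intr_inj.
apply: root_monic_Aint pz _ _; first exact: monic_map.
by apply/polyOverP=> i; rewrite coef_map /= intr_int.
Qed.

Section Norm.

Variable K : fieldExtType rat.
Implicit Types a b c : K.

(** A single embedding into [algC] detects integrality, so the ring structure of [Aint] carries over
    to [ring_of_integers]. *)
Lemma ring_of_integersP (iota : {rmorphism K -> algC}) a :
  ring_of_integers a <-> iota a \in Aint.
Proof.
split=> [|/Aint_integralOver/integralOver_fmorph //].
by move=> /(integralOver_fmorph _ _ iota)/Aint_integralOver.
Qed.

Lemma ring_of_integersB a b :
  ring_of_integers a -> ring_of_integers b -> ring_of_integers (a - b).
Proof.
have [iota] := embedding_exists K algC.
move=> /(ring_of_integersP iota) aI /(ring_of_integersP iota) bI.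
by apply/(ring_of_integersP iota); rewrite rmorphB rpredB.
Qed.

Lemma ring_of_integersM a b :
  ring_of_integers a -> ring_of_integers b -> ring_of_integers (a * b).
Proof.
have [iota] := embedding_exists K algC.
move=> /(ring_of_integersP iota) aI /(ring_of_integersP iota) bI.
by apply/(ring_of_integersP iota); rewrite rmorphM rpredM.
Qed.

Lemma ring_of_integers0 : ring_of_integers (0 : K).
Proof.
have [iota] := embedding_exists K algC.
by apply/(ring_of_integersP iota); rewrite rmorph0.
Qed.

Lemma ring_of_integers1 : ring_of_integers (1 : K).
Proof.
have [iota] := embedding_exists K algC.
by apply/(ring_of_integersP iota); rewrite rmorph1.
Qed.

Lemma field_normM a b : field_norm (a * b) = field_norm a * field_norm b.
Proof. by rewrite /field_norm -!/(mulmat _) mulmatM det_mulmx. Qed.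

Lemma field_norm_eq0 a : (field_norm a == 0) = (a == 0).
Proof.
apply/eqP/eqP=> [a0|->]; last first.
  rewrite /field_norm -/(mulmat _) linear0 -(scale0r 1%:M) detZ.
  by rewrite expr0n gtn_eqF ?dim_gt0 // mul0r.
apply/eqP/negP=> /negP a_neq0.
have := field_normM a a^-1; rewrite divff // a0 mul0r /field_norm -/(mulmat _).
by rewrite mulmat1 det1 => /eqP; rewrite oner_eq0.
Qed.

(** The norm is a product of conjugates of [a], hence a rational algebraic integer, that is, an
    integer; it is nonzero with [a]. *)
Lemma field_norm_int_ge1 a : ring_of_integers a -> a != 0 -> 1 <= `|field_norm a|.
Proof.
move=> a_int a0.
have [s [_ sE sP]] := field_norm_conjugates K algC a.
have N_int : (ratr (field_norm a) : algC) \is a Num.int.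
  apply: Cint_rat_Aint; first exact: Crat_rat.
  have := sP 0; rewrite scale0r subr0 => ->.
  rewrite big_seq rpred_prod // => l /sE[sigma <-].
  by rewrite raddf0 subr0; apply/ring_of_integersP.
apply: norm_intr_ge1; last by rewrite field_norm_eq0.
case/intrP: N_int => m mE; apply/intrP; exists m.
by apply: (fmorph_inj (ratr : {rmorphism rat -> algC})); rewrite /= mE rmorph_int.
Qed.

End Norm.

(** * Characteristic polynomials, and norms computed in different fields *)

Lemma monic1_le1 (F : idomainType) (p : {poly F}) :
  p \is monic -> (size p <= 1)%N -> p = 1.
Proof.
move=> p_monic /size1_polyC pE; move: p_monic.
by rewrite pE monicE lead_coefC => /eqP->.
Qed.

Section Conjugates.

Variable K : fieldExtType rat.
Implicit Types a : K.

(** The hypotheses make [p] the minimal polynomial of [a]. Every root of the characteristic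
    polynomial is a conjugate of [a], so [p] can be divided out repeatedly until a constant is
    left. *)
Lemma char_poly_mulmat_pow a (p : {poly rat}) :
  p \is monic -> (forall q, (horner_alg a q == 0) = (p %| q)) ->
  exists k, char_poly (mulmat a) = p ^+ k.
Proof.
move=> p_monic pP.
have conj_root l : root (map_poly ratr (char_poly (mulmat a))) l ->
    exists sigma : {rmorphism K -> algC}, sigma a = l.
  rewrite map_char_poly -eigenvalue_root_char; exact: embedding_of_eigenvalue.
(* The induction on the degree runs over all monic [P] whose roots are conjugates of [a], a class
   stable under division by [p]. *)
have := char_poly_monic (mulmat a); move: (char_poly _) conj_root => P.
have [n] := ubnP (size P); elim: n P => // n IHn P.
rewrite ltnS => szP P_root P_monic.
have [P1|P_gt1] := leqP (size P) 1.
  by exists 0%N; apply: monic1_le1.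
have [l Pl] : exists l : algC, root (map_poly ratr P) l.
  by apply/closed_rootP; rewrite size_map_poly gtn_eqF.
have [sigma sl] := P_root l Pl.
have p_dvd : p %| P by rewrite -pP -(root_ratr _ _ sigma) sl.
have PE : P = (P %/ p) * p by rewrite divpK.
have Q_monic : P %/ p \is monic by rewrite -(monicMr _ p_monic) -PE.
have p_gt1 : (1 < size p)%N.
  (* If [p] were 1 it would divide the polynomial 1, which would then vanish at [a]. *)
  rewrite ltnNge; apply/negP=> p_le1.
  have p1 : p = 1 by exact: monic1_le1.
  by have := pP 1; rewrite p1 rmorph1 oner_eq0 dvdpp.
have [||k kE] := IHn (P %/ p) _ _ Q_monic.
- apply: leq_trans szP; rewrite size_divp ?monic_neq0 //.
  by rewrite ltn_subrL -subn1 subn_gt0 p_gt1 (leq_trans _ P_gt1).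
- move=> m Qm; apply: P_root; rewrite PE rmorphM rootM Qm //.
- by exists k.+1; rewrite PE kE exprSr.
Qed.

Lemma abs_field_norm a (p : {poly rat}) (k : nat) :
  char_poly (mulmat a) = p ^+ k -> `|field_norm a| = `|p.[0]| ^+ k.
Proof.
move=> E; rewrite -normrX -horner_exp -E horner_coef0 char_poly_det normrM.
by rewrite normrX normrN1 expr1n mul1r.
Qed.

End Conjugates.

(** This is the equality of the normalized norms, with roots cleared. If the characteristic
    polynomials are [p ^+ k] and [p ^+ k'], both sides are the power of [|p(0)|] with exponent
    [k * k' * deg p]. *)
Lemma field_norm_conj (K K' : fieldExtType rat) (C : numFieldType)
    (sigma : {rmorphism K -> C}) (sigma' : {rmorphism K' -> C}) (a : K) (b : K') :
  sigma a = sigma' b ->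
  `|field_norm a| ^+ \dim {:K'} = `|field_norm b| ^+ \dim {:K}.
Proof.
move=> ab; have [iota] := embedding_exists K algC.
have [p [_ p_monic pP]] := minCpolyP (iota a).
have [|k kE] := @char_poly_mulmat_pow _ a p p_monic.
  by move=> q; rewrite -pP root_ratr.
have [|k' kE'] := @char_poly_mulmat_pow _ b p p_monic.
  by move=> q; rewrite -pP root_ratr -(root_ratr _ _ sigma') -ab root_ratr.
rewrite (abs_field_norm _ _ _ _ kE) (abs_field_norm _ _ _ _ kE') -!exprM.
have dimE (F : fieldExtType rat) (c : F) j :
    char_poly (mulmat c) = p ^+ j -> \dim {:F} = (j * (size p).-1)%N.
  move=> /(congr1 (fun q : {poly rat} => size q)); rewrite size_char_poly.
  by move=> /(congr1 predn) /= ->; rewrite size_exp mulnC.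
by rewrite (dimE _ _ _ kE) (dimE _ _ _ kE') mulnCA.
Qed.

(** The bound says that the normalized norm is at least the square root of 2, squared so as to stay
    in the rationals. Raising it to the power of the other degree reduces the transfer to
    [field_norm_conj]. *)
Lemma field_norm_ge_sqrt2 (K K' : fieldExtType rat) (C : numFieldType)
    (sigma : {rmorphism K -> C}) (sigma' : {rmorphism K' -> C}) (a : K) (b : K') :
  sigma a = sigma' b ->
  2 ^+ \dim {:K} <= field_norm a ^+ 2 -> 2 ^+ \dim {:K'} <= field_norm b ^+ 2.
Proof.
move=> ab; rewrite -[field_norm a ^+ 2]real_normK ?num_real //.
rewrite -[field_norm b ^+ 2]real_normK ?num_real // => le2.
rewrite -(@ler_pXn2r _ (\dim {:K})) ?dim_gt0 ?nnegrE ?exprn_ge0 ?normr_ge0 //.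
rewrite [X in _ <= X]exprAC -(field_norm_conj _ _ _ _ _ _ _ ab).
rewrite [X in _ <= X]exprAC [X in X <= _]exprAC.
by rewrite lerXn2r // nnegrE exprn_ge0.
Qed.

(* t >= 2 sqrt(t - 1) at each conjugate t of z, and N(z - 1) is a nonzero
   integer. *)
Lemma field_norm_ge_exp2 (C : numClosedFieldType) (K : fieldExtType rat) (z : K) :
  ring_of_integers z -> z != 1 ->
  (forall sigma : {rmorphism K -> C}, 1 <= sigma z) ->
  2 ^+ \dim {:K} <= `|field_norm z|.
Proof.
move=> z_int z1 z_ge1.
have [s [sz sE sP]] := field_norm_conjugates K C z.
have s_ge1 l : l \in s -> 1 <= l by move=> /sE[sigma <-].
have N1 : 1 <= \prod_(l <- s) (l - 1) :> C.
  have := sP 1; rewrite rmorph1 scale1r => <-.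
  (* All factors [l - 1] are nonnegative, so the norm of [z - 1] equals its absolute value. *)
  have : 0 <= (ratr (field_norm (z - 1)) : C).
    rewrite -[z - 1]/(z - 1) -{1}[1]scale1r sP big_seq prodr_ge0 // => l /s_ge1.
    by rewrite rmorph1 subr_ge0.
  rewrite ler0q => /ger0_norm <-.
  rewrite -(rmorph1 (ratr : {rmorphism rat -> C})) ler_rat.
  apply: field_norm_int_ge1; last by rewrite subr_eq0.
  by apply: ring_of_integersB => //; apply: ring_of_integers1.
have : (4 ^+ \dim {:K} : C) <= (ratr (field_norm z)) ^+ 2.
  have := sP 0; rewrite scale0r subr0 raddf0 => ->.
  rewrite -prodrXl -[X in X <= _]mulr1.
  have -> : 4 ^+ \dim {:K} = \prod_(l <- s) 4 :> C.
    by rewrite big_const_seq count_predT iter_mulr_1 sz.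
  (* Multiplying [4 ^+ n] by the product of the [l - 1], which is at least 1, lets
     [4 * (l - 1) <= l ^+ 2] be used factor by factor. *)
  apply: (le_trans (ler_wpM2l _ N1)); first by rewrite prodr_ge0.
  rewrite -big_split big_seq [X in _ <= X]big_seq; apply: ler_prod => l /s_ge1 l1 /=.
  rewrite mulr_ge0 ?subr_ge0 //= subr0 -subr_ge0.
  have -> : l ^+ 2 - 4 * (l - 1) = (l - 2) ^+ 2 by ring.
  by rewrite real_exprn_even_ge0 // rpredB ?realn // ger0_real // (le_trans ler01).
have -> : 4 ^+ \dim {:K} = ratr ((2 ^+ \dim {:K}) ^+ 2) :> C.
  by rewrite exprAC !rmorphXn /= ratr_nat -[2 ^+ 2 in RHS]natrX.
rewrite -[_ (field_norm z) ^+ 2](rmorphXn (ratr : {rmorphism rat -> C})) /=.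
rewrite ler_rat -[field_norm z ^+ 2]real_normK ?num_real //.
by rewrite ler_pXn2r // ?nnegrE ?exprn_ge0.
Qed.

(** * Totally real elements and complex conjugation on the field obtained by adjoining i *)

Section TotallyReal.

Variable R : realType.
Implicit Types x y a b : algC.

Definition real_conjugates a : Prop :=
  exists (K : fieldExtType rat) (iota : {rmorphism K -> algC}) (k : K),
    iota k = a /\ forall tau : {rmorphism K -> R[i]}, tau k \is Num.real.

(** The choice of number field in [real_conjugates] does not matter: the conjugates of [a] are the
    same computed from any field containing it. *)
Lemma real_conjugatesP a (K : fieldExtType rat) (iota : {rmorphism K -> algC})
    (k : K) (tau : {rmorphism K -> R[i]}) :
  real_conjugates a -> iota k = a -> tau k \is Num.real.
Proof.
move=> [K' [iota' [k' [ka' k_real]]]] ka.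
have [|sigma <-] := @conjugate_embedding K' K _ _ iota' iota tau k' k.
  by rewrite ka ka'.
exact: k_real.
Qed.

(** Two elements are placed in one number field, where each embedding sends both, hence their
    difference and quotient, to reals. *)
Lemma real_conjugates_divring : subfield_of_algC [set a | real_conjugates a].
Proof.
have pair a b : real_conjugates a -> real_conjugates b ->
    real_conjugates (a - b) /\ real_conjugates (a / b).
  move=> aR bR.
  have [E [j [[|a1 [|b1 []]] // [ja jb] _]]] := num_field_exists [:: a; b].
  split; [exists E, j, (a1 - b1) | exists E, j, (a1 / b1)].
    rewrite rmorphB ja jb; split=> // tau.
    rewrite rmorphB rpredB //; first exact: real_conjugatesP ja.
    exact: real_conjugatesP jb.
  rewrite fmorph_div ja jb; split=> // tau.
  rewrite fmorph_div rpred_div //; first exact: real_conjugatesP ja.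
  exact: real_conjugatesP jb.
split.
- rewrite inE; have [E [j _]] := num_field_exists [::].
  by exists E, j, 1; rewrite rmorph1; split=> // tau; rewrite rmorph1 rpred1.
- by move=> a b; rewrite !inE => aR bR; have [] := pair a b aR bR.
- by move=> a b; rewrite !inE => aR bR; have [] := pair a b aR bR.
Qed.

Lemma Qtr_real_conjugates a : Qtr R a -> real_conjugates a.
Proof.
apply: (smallest_sub real_conjugates_divring).
move=> b [F [K [iota [K_real ->]]] [k _ <-]].
by exists K, iota, k; split=> // tau; apply: K_real.
Qed.

(** The explicit form [a + b * 'i] makes complex conjugation computable under every embedding. *)
Definition gaussian_conjugates y : Prop :=
  exists a b, [/\ real_conjugates a, real_conjugates b & y = a + b * 'i].

Lemma gaussian_conjugates_divring :
  subfield_of_algC [set y | gaussian_conjugates y].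
Proof.
have [one sub dv] := real_conjugates_divring.
have R1 : real_conjugates 1 by move: one; rewrite inE.
have RB a b : real_conjugates a -> real_conjugates b -> real_conjugates (a - b).
  by move=> aR bR; have := sub a b; rewrite !inE; apply.
have Rdiv a b : real_conjugates a -> real_conjugates b -> real_conjugates (a / b).
  by move=> aR bR; have := dv a b; rewrite !inE; apply.
have R0 : real_conjugates 0 by rewrite -(subrr 1); apply: RB.
have RN a : real_conjugates a -> real_conjugates (- a).
  by move=> aR; rewrite -sub0r; apply: RB.
have RD a b : real_conjugates a -> real_conjugates b -> real_conjugates (a + b).
  by move=> aR bR; rewrite -[b]opprK; apply: RB => //; apply: RN.
have RV a : real_conjugates a -> real_conjugates a^-1.
  by move=> aR; rewrite -div1r; apply: Rdiv.
have RM a b : real_conjugates a -> real_conjugates b -> real_conjugates (a * b).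
  by move=> aR bR; rewrite -[b]invrK; apply: Rdiv => //; apply: RV.
have i2 : 'i * 'i = -1 :> algC by rewrite -expr2 sqrCi.
have GM y z : gaussian_conjugates y -> gaussian_conjugates z ->
    gaussian_conjugates (y * z).
  move=> [a [b [aR bR ->]]] [c [d [cR dR ->]]].
  exists (a * c - b * d), (a * d + b * c); split.
  - by apply: RB; apply: RM.
  - by apply: RD; apply: RM.
  - have -> : (a + b * 'i) * (c + d * 'i)
      = a * c + b * d * ('i * 'i) + (a * d + b * c) * 'i by ring.
    by rewrite i2; ring.
have GV y : gaussian_conjugates y -> gaussian_conjugates y^-1.
  move=> [a [b [aR bR yE]]].
  have [y0|y0] := eqVneq y 0.
    by exists 0, 0; rewrite y0 invr0 mul0r addr0.
  (* Inversion goes through [a - b * 'i]. Since [a] and [b] are not known here to be real inside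
     [algC], this factor may vanish; then [y] is [a + a]. *)
  have [w0|w0] := eqVneq (a - b * 'i) 0.
    exists (a + a)^-1, 0; rewrite mul0r addr0; split=> //; first exact/RV/RD.
    by rewrite yE; congr (_ + _)^-1; apply/esym/eqP; rewrite -subr_eq0 w0.
  have NE : y * (a - b * 'i) = a * a + b * b.
    have -> : y * (a - b * 'i) = a * a - b * b * ('i * 'i) by rewrite yE; ring.
    by rewrite i2; ring.
  have N0 : a * a + b * b != 0 by rewrite -NE mulf_neq0.
  have NR : real_conjugates (a * a + b * b) by apply: RD; apply: RM.
  exists (a / (a * a + b * b)), (- b / (a * a + b * b)); split.
  - exact: Rdiv.
  - by apply: Rdiv => //; apply: RN.
  - apply: (mulfI y0); rewrite divff //.
    have -> : y * (a / (a * a + b * b) + - b / (a * a + b * b) * 'i)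
        = y * (a - b * 'i) / (a * a + b * b) by ring.
    by rewrite NE divff.
split.
- by rewrite inE; exists 1, 0; rewrite mul0r addr0.
- move=> y z; rewrite !inE => -[a [b [aR bR ->]]] [c [d [cR dR ->]]].
  exists (a - c), (b - d); split; [exact: RB|exact: RB|by ring].
- by move=> y z; rewrite !inE => yG zG; apply: GM => //; apply: GV.
Qed.

Lemma Qtr_i_gaussian_conjugates y : Qtr_i R y -> gaussian_conjugates y.
Proof.
have [one sub _] := real_conjugates_divring.
have R1 : real_conjugates 1 by move: one; rewrite inE.
have R0 : real_conjugates 0 by have := sub 1 1; rewrite !inE subrr; apply.
apply: (smallest_sub gaussian_conjugates_divring) => z [/Qtr_real_conjugates zR|->].
  by exists z, 0; rewrite mul0r addr0.
by exists 0, 1; rewrite mul1r add0r.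
Qed.

(* The given number field containing y need not contain its complex conjugate w,
   whence the auxiliary field E. *)
Lemma Qtr_i_conj y : Qtr_i R y ->
  exists (E : fieldExtType rat) (j : {rmorphism E -> algC}) (y1 w1 : E),
    j y1 = y /\ forall tau : {rmorphism E -> R[i]}, tau w1 = (tau y1)^*.
Proof.
move=> /Qtr_i_gaussian_conjugates[a [b [aR bR yE]]].
have [E [j [[|a1 [|b1 [|i1 []]]] // [ja jb ji] _]]] :=
  num_field_exists [:: a; b; 'i].
exists E, j, (a1 + b1 * i1), (a1 - b1 * i1).
split=> [|tau]; first by rewrite rmorphD rmorphM ja jb ji.
have i1E : i1 ^+ 2 = -1.
  by apply: (fmorph_inj j); rewrite rmorphXn rmorphN1 ji sqrCi.
(* An embedding may send [i1] to either square root of -1; conjugation negates both, so the same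
   [w1] works for every [tau]. *)
have tauiE : (tau i1)^* = - tau i1.
  have /eqP : tau i1 ^+ 2 = 'i ^+ 2 by rewrite -rmorphXn i1E rmorphN1 sqrCi.
  rewrite eqf_sqr => /orP[]/eqP->; first exact: conjCi.
  by rewrite rmorphN /= conjCi.
rewrite !rmorphD !rmorphM rmorphN rmorphM /= tauiE mulrN.
have /CrealP-> := real_conjugatesP _ _ _ _ tau aR ja.
by have /CrealP-> := real_conjugatesP _ _ _ _ tau bR jb.
Qed.

End TotallyReal.

(** * Principal ideals, logarithmic bounds and the conclusion *)

Lemma principal_ideal_is_ideal (K : fieldExtType rat) (y : K) :
  ring_of_integers y -> is_ideal (principal_ideal y).
Proof.
move=> y_int; split.
- by move=> _ [c c_int <-]; apply: ring_of_integersM.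
- by exists 0; [exact: ring_of_integers0|rewrite mulr0].
- move=> _ _ [c c_int <-] [d d_int <-]; exists (c + d); last by rewrite mulrDr.
  rewrite -[d]opprK; apply: ring_of_integersB => //; rewrite -sub0r.
  by apply: ring_of_integersB => //; exact: ring_of_integers0.
- move=> c _ c_int [d d_int <-]; exists (c * d); first exact: ring_of_integersM.
  by rewrite mulrCA.
Qed.

Lemma log_norm_ge (R : realType) (x : algC) :
  x != 0 -> 2 ^+ \dim {:Qadj x} <= field_norm (Qadj_gen x) ^+ 2 ->
  2^-1 * ln 2 <= log_norm R x.
Proof.
move=> x0 le2; rewrite /log_norm ler_pdivlMr ?ltr0n ?dim_gt0 //.
rewrite -ratr_norm; set N := `|field_norm _| in le2 *.
have g0 : Qadj_gen x != 0 by rewrite -(fmorph_eq0 (Qadj_incl x)) Qadj_inclK.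
have N0 : 0 < (ratr N : R) by rewrite ltr0q normr_gt0 field_norm_eq0.
have {}le2 : 2 ^+ \dim {:Qadj x} <= (ratr N : R) ^+ 2.
  have := le2; rewrite -[field_norm _ ^+ 2]real_normK ?num_real //.
  by rewrite -(ler_rat R) !rmorphXn /= ratr_nat.
rewrite -mulrA ler_pdivrMl ?ltr0n // !mulr_natr mulr_natl -!lnXn //.
by rewrite ler_ln // posrE exprn_gt0.
Qed.

Lemma ln_golden_ratio_lt (R : realType) : ln ((1 + Num.sqrt 5) / 2) < ln 2 :> R.
Proof.
have s5 : Num.sqrt 5 < 3 :> R.
  by rewrite -[3]ger0_norm // -sqrtr_sqr ltr_sqrt ?exprn_gt0 //; lra.
have s0 : 0 <= Num.sqrt 5 :> R by exact: sqrtr_ge0.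
rewrite ltr_ln ?posrE //; last by apply: divr_gt0; lra.
by rewrite ltr_pdivrMr //; lra.
Qed.

Lemma large_element_norm (R : realType) (K : fieldExtType rat)
    (iota : {rmorphism K -> algC}) (y : K) :
  Qtr_i R (iota y) -> large_element R y ->
  (exists2 w, w \in Aint & iota y * w = 1) \/
  2 ^+ \dim {:K} <= field_norm y ^+ 2.
Proof.
move=> yL [y_int y_large].
have [E [j [y1 [w1 [jy w_conj]]]]] := Qtr_i_conj R _ yL.
have y1_int : ring_of_integers y1.
  by apply/(ring_of_integersP _ j); rewrite jy; apply/ring_of_integersP.
have [tau0] := embedding_exists E R[i].
(* Since [tau0 w1] equals [tauc y1], the elements [w1] and [y1] are conjugate over the rationals:
   integrality and the absolute value of the norm pass from [y1] to [w1]. *)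
pose tauc : {rmorphism E -> R[i]} := Num.conj \o tau0.
have w1_int : ring_of_integers w1.
  apply/(integralOver_fmorph _ _ tau0); rewrite w_conj.
  exact/(integralOver_fmorph _ _ tauc).
have tau_large (tau : {rmorphism E -> R[i]}) : 1 <= tau (y1 * w1).
  rewrite rmorphM /= w_conj -normCK.
  (* Largeness of [y] concerns embeddings of [K], whereas [tau] is defined on [E]; its value at [y1]
     is also taken by an embedding of [K] at [y]. *)
  have [sigma <-] := conjugate_embedding _ _ _ _ iota j tau _ _ (esym jy).
  by rewrite exprn_ege1.
have [yw1|yw1] := eqVneq (y1 * w1) 1.
  left; exists (j w1); first exact/ring_of_integersP.
  by rewrite -jy -rmorphM yw1 rmorph1.
right; apply: (field_norm_ge_sqrt2 _ _ _ j iota _ _ jy).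
have yw_int : ring_of_integers (y1 * w1) by exact: ring_of_integersM.
have := field_norm_ge_exp2 _ _ _ yw_int yw1 tau_large.
rewrite field_normM normrM -[field_norm y1 ^+ 2]real_normK ?num_real //.
have -> : `|field_norm w1| = `|field_norm y1|.
  apply: (@pexpIrn _ (\dim {:E})); rewrite ?nnegrE ?dim_gt0 //.
  exact: (field_norm_conj _ _ _ tau0 tauc _ _ (w_conj tau0)).
by rewrite expr2.
Qed.

Theorem proposition3p3 (R : realType) (x : algC)
  (x_int : integers_in (Qtr_i R) x) (x_neq0 : x != 0)
  (x_norm : log_norm R x < 2^-1 * ln ((1 + Num.sqrt 5) / 2))
  (x_nunit : ~ unit_of (integers_in (Qtr_i R)) x) :
  ~ large_in R (Qtr_i R) (Qadj_incl x) (principal_ideal (Qadj_gen x)).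
Proof.
move=> [K [iota [phi [iotaE iotaL [y y_large idealE]]]]].
have [xL x_Aint] := x_int.
have [y_int _] := y_large.
have xE : iota (phi (Qadj_gen x)) = x by rewrite -[RHS]Qadj_inclK -iotaE.
have phix_int : ring_of_integers (phi (Qadj_gen x)).
  by apply/(ring_of_integersP _ iota); rewrite xE.
(* Equality of the two ideals gives divisibility both ways: [y] divides [x] for the norm bound, and
   [x] divides [y] for the unit case. *)
have x_in : principal_ideal y (phi (Qadj_gen x)).
  rewrite -idealE; apply: sub_gen_smallest; exists (Qadj_gen x) => //.
  by exists 1; [exact: ring_of_integers1|rewrite mulr1].
have y_in : principal_ideal (phi (Qadj_gen x)) y.
  suff : (principal_ideal y `<=` principal_ideal (phi (Qadj_gen x)))%classic.
    by apply; exists 1; [exact: ring_of_integers1|rewrite mulr1].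
  rewrite -idealE; apply: smallest_sub; first exact: principal_ideal_is_ideal.
  move=> _ [_ [c c_int <-] <-]; exists (phi c); last by rewrite rmorphM.
  exact/integralOver_fmorph.
have yL : Qtr_i R (iota y) by apply: iotaL; exists y.
have [[w w_int yw1]|y_norm] := large_element_norm _ _ iota _ yL y_large.
  case: y_in => c c_int yE; apply: x_nunit; split=> //.
  have xcw : x * (iota c * w) = 1 by rewrite -xE mulrA -rmorphM yE.
  exists (iota c * w) => //; split; last first.
    by rewrite rpredM //; apply/ring_of_integersP.
  (* Written as a quotient, the inverse of [x] lies in every subfield containing the generators of
     [Qtr_i R], hence in [Qtr_i R]. *)
  have -> : iota c * w = 1 / x by rewrite -xcw mulrAC divff ?mul1r.
  move=> M ML; have [[M1 _ Mdiv] _] := ML; have := Mdiv 1 x; rewrite !inE; apply.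
    by move: M1; rewrite inE.
  exact: xL.
case: x_in => c c_int xc.
have x0 : phi (Qadj_gen x) != 0.
  by rewrite -(fmorph_eq0 iota) xE.
have c0 : c != 0 by apply: contraNneq x0 => c0; rewrite -xc c0 mulr0.
(* The cofactor [c] is a nonzero integer, so its norm has absolute value at least 1 and the bound
   for [y] passes to its multiple [x]. *)
have phix_norm : 2 ^+ \dim {:K} <= field_norm (phi (Qadj_gen x)) ^+ 2.
  apply: (le_trans y_norm); rewrite -xc field_normM exprMn.
  rewrite ler_peMr ?sqr_ge0 // -real_normK ?num_real //.
  by rewrite exprn_ege1 // field_norm_int_ge1.
have := field_norm_ge_sqrt2 _ _ _ iota (Qadj_incl x) _ _ _ phix_norm.
move=> /(_ (Qadj_gen x)); rewrite xE Qadj_inclK => /(_ erefl).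
move=> /(log_norm_ge R x x_neq0) x_ge.
have := le_lt_trans x_ge x_norm.
by rewrite ltr_pM2l ?invr_gt0 ?ltr0n // ltNge (ltW (ln_golden_ratio_lt R)).
Qed.
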